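(* Let $G$ be a finite simple graph of order $n$ and size $m$. If $m\leq 0.0851\,n^2$ and $G$ is $2$-connected, then $\mathrm{nRel}(G;p)$ has at least two distinct points of inflection in $(0,1)$ (points at which the second derivative changes sign).
   Context: For a graph $G$ on $n$ vertices, a connected set is a nonempty vertex subset $C$ such that the induced subgraph $G[C]$ is connected. The node reliability of $G$ is the polynomial \[ \mathrm{nRel}(G;p)=\sum_{C}p^{|C|}(1-p)^{n-|C|}, \] the sum over all connected sets $C$ of $G$. The size of $G$ is its number of edges. *)

(* Defs.v *)
From HB Require Import structures.
From mathcomp Require Import all_boot all_order all_algebra.
From mathcomp Require Import reals.
Set Implicit Arguments. Unset Strict Implicit. Unset Printing Implicit Defensive.
Import Order.TTheory GRing.Theory Num.Theory.

(* A finite simple graph: vertex set T (a finType), adjacency e : rel T,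
   assumed symmetric and irreflexive (hypotheses of the theorem). *)

Definition gorder (T : finType) : nat := #|T|.

Definition edges (T : finType) (e : rel T) : {set {set T}} :=
  [set [set p.1; p.2] | p in [set p : T * T | e p.1 p.2]].

Definition gsize (T : finType) (e : rel T) : nat := #|edges e|.

Definition induced (T : finType) (e : rel T) (C : {set T}) : rel T :=
  [rel x y | [&& x \in C, y \in C & e x y]].

Definition connected_set (T : finType) (e : rel T) (C : {set T}) : bool :=
  (C != set0) && [forall x in C, forall y in C, connect (induced e C) x y].

Definition two_connected (T : finType) (e : rel T) : bool :=
  [&& 2 < #|T|, connected_set e [set: T] &
      [forall v : T, connected_set e (~: [set v])]].

Local Open Scope ring_scope.

Definition nRel (R : nzRingType) (T : finType) (e : rel T) : {poly R} :=
  \sum_(C : {set T} | connected_set e C)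
     'X ^+ #|C| * (1 - 'X) ^+ (#|T| - #|C|)%N.

Definition sign_change (R : realType) (f : R -> R) (x : R) : Prop :=
  exists2 eps : R, 0 < eps &
    ((forall t, x - eps < t < x -> f t < 0) /\ (forall t, x < t < x + eps -> 0 < f t))
    \/
    ((forall t, x - eps < t < x -> 0 < f t) /\ (forall t, x < t < x + eps -> f t < 0)).

Definition inflection (R : realType) (p : {poly R}) (x : R) : Prop :=
  sign_change (fun t => (p^`(2)).[t]) x.

(* Main.v *)
(* Write n for the order, m for the size, N = n - 1 and f = nRel(G). Keeping
   only the singletons and the edges gives
     f(p) >= n p (1-p)^N + m p^2 (1-p)^(n-2),
   while a connected set C spans at least |C| - 1 edges, so that weighting each
   C by (number of edges inside C) / (|C| - 1) gives
     f(p) <= n p (1-p)^N + m p (1 - (1-p)^N) / N.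
   For m <= 0.0851 n^2 these two bounds yield f(3/n) < f(1/n). Since f(0) = 0,
   f(1) = 1 >= f and, by 2-connectedness, f'(1) = 0, the mean value theorem
   makes f' positive, negative, positive and finally zero along (0,1], hence
   f'' negative, positive, negative, and a polynomial going from one sign to
   the other has a root of odd multiplicity in between. *)
Require Import Defs.
From HB Require Import structures.
From mathcomp Require Import all_boot all_order all_algebra.
From mathcomp Require Import reals.
From mathcomp Require Import ring lra.
From mathcomp Require Import polyrcf sequences exp.
Import Order.TTheory GRing.Theory Num.Theory.
Local Open Scope ring_scope.

(** * Binomial sums over subsets *)

Lemma sum_subsets_card (V : nmodType) (T : finType) (A : {set T}) (h : nat -> V) :
  \sum_(D : {set T} | D \subset A) h #|D| = \sum_(j < #|A|.+1) h j *+ 'C(#|A|, j).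
Proof.
rewrite (partition_big (fun D : {set T} => inord #|D| : 'I_#|A|.+1) predT) //=.
apply: eq_bigr => j _; rewrite -cards_draws -sumr_const.
apply: eq_big => [D|D /andP[DA /eqP <-]].
  rewrite inE; apply: andb_id2l => /subset_leq_card DA.
  by rewrite -val_eqE /= inordK ?ltnS.
by rewrite inordK // ltnS subset_leq_card.
Qed.

(** The ring is general because [p] is a real number in [nRel_le1] and the indeterminate ['X] in
    [nRel_near1]. *)
Lemma sum_weights (R : comNzRingType) (T : finType) (p q : R) : p + q = 1 ->
  \sum_(C : {set T}) p ^+ #|C| * q ^+ (#|T| - #|C|) = 1.
Proof.
move=> pq; transitivity ((q + p) ^+ #|T|); last by rewrite addrC pq expr1n.
rewrite exprDn -[in RHS]cardsT -(sum_subsets_card _ _ setT (fun j => q ^+ (_ - j) * p ^+ j)) cardsT.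
by apply: eq_big => [D|D _]; rewrite ?subsetT // mulrC.
Qed.

(** Put k = n - 2 and sum over complements of size i. Since C(k,i) / (k+1-i) = C(k+1,i) / (k+1), the
    sum becomes the binomial expansion of (p+q)^(k+1) without its last term q^(k+1). *)
Lemma sum_weights_supset (R : numFieldType) (T : finType) (p q : R) (E : {set T}) :
  p + q = 1 -> #|E| = 2%N ->
  \sum_(C : {set T} | E \subset C) p ^+ #|C| * q ^+ (#|T| - #|C|) / #|C|.-1%:R
    = p * (1 - q ^+ #|T|.-1) / #|T|.-1%:R.
Proof.
move=> pq E2; have cE : #|~: E| = #|T|.-2 by rewrite -(cardsC E) E2.
have [k Tk] : exists k, #|T| = k.+2.
  by exists #|T|.-2; rewrite -(cardsC E) E2.
rewrite (reindex_inj (@setC_inj T)) /=.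
transitivity (\sum_(D : {set T} | D \subset ~: E)
   p ^+ (#|T| - #|D|) * q ^+ #|D| / (#|T| - #|D|).-1%:R).
  apply: eq_big => [D|D _]; first by rewrite -setCS setCK.
  by rewrite [#|~: D|]cardsCs setCK subKn // max_card.
rewrite (sum_subsets_card _ _ _ (fun j => p ^+ (_ - j) * q ^+ j / (_ - j).-1%:R)) cE Tk /=.
have -> : 1 - q ^+ k.+1 = (p + q) ^+ k.+1 - q ^+ k.+1 by rewrite pq expr1n.
rewrite exprDn [X in _ = p * (X - _) / _]big_ord_recr /= subnn mul1r binn mulr1n addrK mulr_sumr mulr_suml.
apply: eq_bigr => i _; have ik : (i <= k)%N by rewrite -ltnS.
rewrite !subSn ?(leqW ik) //= exprS.
rewrite -[LHS]mulr_natr -[X in _ = p * X / _]mulr_natr.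
have h : k.+1%:R * 'C(k, i)%:R = (k - i).+1%:R * 'C(k.+1, i)%:R :> R.
  by rewrite -!natrM mul_bin_down subSn.
have k0 : k.+1%:R != 0 :> R by rewrite pnatr_eq0.
have i0 : (k - i).+1%:R != 0 :> R by rewrite pnatr_eq0.
have -> : 'C(k, i)%:R = (k - i).+1%:R * 'C(k.+1, i)%:R / k.+1%:R :> R.
  by rewrite -h mulrAC mulfV // mul1r.
by field; rewrite !nat1r k0 i0.
Qed.

(** * Edges inside connected sets *)

Section ConnectedSets.
Variables (T : finType) (e : rel T).
Hypotheses (e_sym : symmetric e) (e_irr : irreflexive e).

(** A path inside [C] from a vertex of [A] to one outside must cross the boundary of [A]; the
    induction finds the first crossing. *)
Lemma connected_set_exit (C A : {set T}) :
  connected_set e C -> A \proper C -> A != set0 ->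
  exists x y, [/\ x \in A, y \in C :\: A & e x y].
Proof.
move=> /andP[_ /forall_inP cC] /properP[AC [y yC yA]] /set0Pn[x xA].
have /connectP[s sp yl] := forall_inP (cC x (subsetP AC x xA)) y yC.
elim: s x xA sp yl => [|z s IHs] x xA /=; first by move=> _ yx; rewrite yx xA in yA.
case/andP=> /and3P[xC zC xz] sp yl.
have [zA|zA] := boolP (z \in A); first exact: IHs zA sp yl.
by exists x, z; rewrite inE zA.
Qed.

Lemma connected_set_edges (C : {set T}) :
  connected_set e C -> (#|C|.-1 <= #|[set E in edges e | E \subset C]|)%N.
Proof.
move=> cC.
have [C0|] := leqP #|C| 1; first by have -> : #|C|.-1 = 0%N by apply/eqP; rewrite -subn1 subn_eq0.
(* Grow a subset of [C] one vertex at a time: the edge that reaches the new vertex was not inside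
   the earlier subset, so the edge count rises too. *)
have grow k : (k < #|C|)%N -> exists A : {set T},
    [/\ A \subset C, #|A| = k.+1 & (k <= #|[set E in edges e | E \subset A]|)%N].
  elim: k => [|k IHk] kC.
    have /card_gt0P[x xC] := kC.
    by exists [set x]; rewrite sub1set cards1.
  have [A [AC Ak kA]] := IHk (ltnW kC).
  have [||x [y [xA /setDP[yC yA] xy]]] := connected_set_exit C A cC.
  - by rewrite properEcard AC Ak.
  - by rewrite -card_gt0 Ak.
  exists (y |: A); split; first by rewrite subUset sub1set yC.
    by rewrite cardsU1 yA Ak.
  apply: leq_ltn_trans kA _; apply: proper_card; apply/properP; split.
    apply/subsetP=> E; rewrite !inE => /andP[-> /subset_trans -> //].
    exact: subsetUr.
  exists [set x; y].
    rewrite inE subUset !sub1set !inE eqxx xA orbT /= andbT.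
    by apply/imsetP; exists (x, y); rewrite ?inE.
  by rewrite inE subUset !sub1set (negPf yA) !andbF.
move=> C1; have [A [AC Ak]] := grow #|C|.-1 (ltac:(by rewrite (ltn_predK C1))).
suff -> : A = C by [].
by apply/eqP; rewrite eqEcard AC Ak (ltn_predK C1) /=.
Qed.

Lemma card_edge (E : {set T}) : E \in edges e -> #|E| = 2%N.
Proof.
case/imsetP=> -[x y]; rewrite inE /= => xy ->; rewrite cards2.
by have [yx|//] := eqVneq x y; rewrite yx e_irr in xy.
Qed.

Lemma connected_set1 (x : T) : connected_set e [set x].
Proof.
rewrite /connected_set -card_gt0 cards1 /=.
by apply/forall_inP=> y /set1P ->; apply/forall_inP=> z /set1P ->; apply: connect0.
Qed.

Lemma connected_set_edge (E : {set T}) : E \in edges e -> connected_set e E.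
Proof.
case/imsetP=> -[x y]; rewrite inE /= => xy ->.
rewrite /connected_set -card_gt0 cards2 ltnS leq0n /=.
apply/forall_inP=> u /set2P[]->; apply/forall_inP=> v /set2P[]->;
  do ?exact: connect0; apply: connect1;
  by rewrite /induced /= set21 set22 ?xy // e_sym.
Qed.

End ConnectedSets.

(** * Upper and lower bounds on the node reliability *)

Section Bounds.
Variables (R : realType) (T : finType) (e : rel T).
Hypotheses (e_sym : symmetric e) (e_irr : irreflexive e).

Lemma horner_nRel (t : R) : (nRel R e).[t] =
  \sum_(C : {set T} | connected_set e C) t ^+ #|C| * (1 - t) ^+ (#|T| - #|C|).
Proof.
rewrite /nRel horner_sum; apply: eq_bigr => C _.
by rewrite hornerM !horner_exp !hornerE.
Qed.

Variable p : R.
Hypothesis p01 : 0 <= p <= 1.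
Let w (C : {set T}) := p ^+ #|C| * (1 - p) ^+ (#|T| - #|C|).

Let w_ge0 C : 0 <= w C.
Proof. by case/andP: p01 => p0 p1; rewrite mulr_ge0 ?exprn_ge0 ?subr_ge0. Qed.

Lemma nRel_le1 : (nRel R e).[p] <= 1.
Proof.
rewrite horner_nRel -[leRHS](sum_weights _ T p (1 - p)) ?subrKC //.
by rewrite [leRHS](bigID (connected_set e)) /= lerDl sumr_ge0 // => C _; exact: w_ge0.
Qed.

Local Hint Resolve w_ge0 : core.

Let nRel_w : (nRel R e).[p] = \sum_(C | connected_set e C) w C.
Proof. exact: horner_nRel. Qed.

Let sum_w_card k :
  \sum_(C : {set T} | #|C| == k) w C = p ^+ k * (1 - p) ^+ (#|T| - k) *+ 'C(#|T|, k).
Proof.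
rewrite -card_draws -sumr_const; apply: eq_big => [C|C /eqP Ck]; first by rewrite inE.
by rewrite /w Ck.
Qed.

Lemma nRel_lower : #|T|%:R * p * (1 - p) ^+ #|T|.-1
   + (gsize e)%:R * p ^+ 2 * (1 - p) ^+ #|T|.-2 <= (nRel R e).[p].
Proof.
have -> : #|T|%:R * p * (1 - p) ^+ #|T|.-1 = \sum_(C : {set T} | #|C| == 1%N) w C.
  by rewrite sum_w_card bin1 expr1 subn1 -[RHS]mulr_natl mulrA.
have -> : (gsize e)%:R * p ^+ 2 * (1 - p) ^+ #|T|.-2 = \sum_(E in edges e) w E.
  rewrite -mulrA mulr_natl -sumr_const; apply: eq_bigr => E /(card_edge _ _ e_irr) E2.
  by rewrite /w E2 subn2.
rewrite nRel_w [leRHS](bigID (fun C : {set T} => #|C| == 1%N)) /=.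
apply: lerD; rewrite [leLHS]big_mkcond [leRHS]big_mkcond /=; apply: ler_sum => C _.
  case: ifP => [/cards1P[x ->]|_]; first by rewrite connected_set1.
  by rewrite andbF.
case: ifP => [CE|_]; last by case: ifP.
by rewrite connected_set_edge // (card_edge _ _ e_irr).
Qed.

Lemma nRel_upper : (nRel R e).[p] <= #|T|%:R * p * (1 - p) ^+ #|T|.-1
   + (gsize e)%:R * (p * (1 - (1 - p) ^+ #|T|.-1) / #|T|.-1%:R).
Proof.
have -> : #|T|%:R * p * (1 - p) ^+ #|T|.-1 = \sum_(C : {set T} | #|C| == 1%N) w C.
  by rewrite sum_w_card bin1 expr1 subn1 -[RHS]mulr_natl mulrA.
(* Exchange the sums: by [sum_weights_supset], every edge contributes the same amount. *)
have -> : (gsize e)%:R * (p * (1 - (1 - p) ^+ #|T|.-1) / #|T|.-1%:R) =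
    \sum_(C : {set T}) \sum_(E in edges e | E \subset C) w C / #|C|.-1%:R.
  rewrite (exchange_big_dep (mem (edges e))) /=; last by move=> C E _ /andP[].
  rewrite mulr_natl -sumr_const; apply: eq_bigr => E eE.
  rewrite -(sum_weights_supset _ T p (1 - p) E) ?subrKC ?(card_edge _ _ e_irr) //.
  by apply: eq_bigl => C; rewrite eE.
rewrite nRel_w big_mkcond /= [X in X + _]big_mkcond -big_split /=.
apply: ler_sum => C _; set s := \sum_(E in _ | _) _.
have s0 : 0 <= s by apply: sumr_ge0 => E _; rewrite mulr_ge0 ?invr_ge0.
case: ifP => cC; last by rewrite addr_ge0 //; case: ifP.
case: ifPn => C1; first by rewrite lerDl.
have C2 : (1 < #|C|)%N.
  by rewrite ltn_neqAle eq_sym C1 card_gt0; case/andP: cC.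
have -> : s = #|[set E in edges e | E \subset C]|%:R * (w C / #|C|.-1%:R).
  by rewrite mulr_natl -sumr_const; apply: eq_bigl => E; rewrite inE.
have c0 : 0 < #|C|.-1%:R :> R by rewrite ltr0n -subn1 subn_gt0.
rewrite add0r mulrCA ler_peMr // ler_pdivlMr // mul1r ler_nat.
exact: connected_set_edges.
Qed.

End Bounds.

(** * Sign changes of polynomials *)

Lemma horner_near_same_sign (R : realType) (p : {poly R}) (x : R) : p.[x] != 0 ->
  exists2 d, 0 < d & forall t, `|t - x| < d -> 0 < p.[t] * p.[x].
Proof.
move=> px0; have [d d0 dP] := poly_cont x p (ltac:(by rewrite normr_gt0) : 0 < `|p.[x]|).
exists d => // t /dP; have [px|px|/eqP] := ltgtP p.[x] 0; last by rewrite (negPf px0).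
  by rewrite ltr_norml (ltr0_norm px) nmulr_lgt0 //; lra.
by rewrite ltr_norml (gtr0_norm px) pmulr_lgt0 //; lra.
Qed.

(** This restores an even power of t - x after it was divided out. If y differs from x, the radius
    shrinks to keep x away; if y = x, the one-sided intervals already omit x. *)
Lemma sign_change_mul (R : realType) (f g : R -> R) (x y : R) :
  (forall t, t != x -> 0 < g t) -> sign_change f y ->
  sign_change (fun t => g t * f t) y.
Proof.
move=> g0 [eps eps0 fs].
pose d := if x == y then eps else Num.min eps `|x - y|.
have d0 : 0 < d by rewrite /d; case: eqP => // /eqP xy; rewrite lt_min eps0 normr_gt0 subr_eq0.
have de : d <= eps by rewrite /d; case: eqP => // _; rewrite ge_min lexx.
have gd t : t != y -> y - d < t < y + d -> 0 < g t.
  move=> ty td; apply: g0; apply: contraNneq ty => tx; move: td; rewrite /d tx.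
  case: eqP => // _ td; suff : `|x - y| < `|x - y| by rewrite ltxx.
  by rewrite {1}ltr_norml; have := ge_min `|x - y| eps `|x - y|; rewrite lexx orbT; lra.
exists d => //; case: fs => -[fl fr]; [left|right]; split=> t td.
- by rewrite pmulr_rlt0 ?fl ?gd ?lt_eqF //; lra.
- by rewrite pmulr_rgt0 ?fr ?gd ?gt_eqF //; lra.
- by rewrite pmulr_rgt0 ?fl ?gd ?lt_eqF //; lra.
- by rewrite pmulr_rlt0 ?fr ?gd ?gt_eqF //; lra.
Qed.

(** Induction on the size. A root of odd multiplicity is a sign change; for an even multiplicity k,
    the cofactor of (t - x)^k is smaller and still has opposite signs at [a] and [b]. *)
Lemma poly_sign_change (R : realType) (p : {poly R}) (a b : R) : a < b ->
  p.[a] * p.[b] < 0 -> exists2 x, a < x < b & sign_change (horner p) x.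
Proof.
move=> ab; have [n] := ubnP (size p); elim: n p => // n IHn p /ltnSE sp pab.
have p0 : p != 0 by apply: contraTneq pab => ->; rewrite !horner0 mul0r ltxx.
have [x xab rx] := polyrcf.poly_ivt (ltW ab) (ltW pab).
have {xab} xab : a < x < b.
  move: xab; rewrite in_itv /= !lt_neqAle => /andP[-> ->]; move/eqP: rx => rx.
  rewrite !andbT; apply/andP; split; apply: contraTneq pab.
    by move=> ->; rewrite rx mul0r ltxx.
  by move=> <-; rewrite rx mulr0 ltxx.
have [k [q]] := multiplicity_XsubC p x; rewrite p0 /= => qx pE.
have pt t : p.[t] = (t - x) ^+ k * q.[t] by rewrite pE hornerM horner_exp hornerXsubC mulrC.
have k0 : k != 0%N by apply: contraNneq qx => k0; move: rx; rewrite pE k0 expr0 mulr1.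
have q0 : q != 0 by apply: contraNneq qx => ->; rewrite root0.
have [ko|ke] := boolP (odd k); last first.
  have ev t : t != x -> 0 < (t - x) ^+ k by move=> tx; rewrite exprn_even_gt0 // subr_eq0 tx orbT.
  have sq : (size q < n)%N.
    apply: leq_trans sp; rewrite pE size_Mmonic ?monic_exp ?monicXsubC // size_exp_XsubC addnS /=.
    by rewrite -[ltnLHS]addn0 ltn_add2l lt0n.
  have [|y yab ysc] := IHn q sq.
    move: pab; rewrite !pt mulrACA pmulr_rlt0 // mulr_gt0 // ev //; lra.
  exists y => //; have [eps e0 h] := sign_change_mul _ _ (fun t => (t - x) ^+ k) x y ev ysc.
  by exists eps => //; case: h => -[hl hr]; [left|right]; split=> t ht; rewrite pt ?hl ?hr.
have [d d0 dq] := horner_near_same_sign _ _ _ qx.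
exists x => //; exists d => //.
have qs t : x - d < t < x + d -> 0 < q.[t] * q.[x] by move=> td; apply: dq; rewrite ltr_norml; lra.
have neg t : t < x -> (t - x) ^+ k < 0 by move=> tx; rewrite exprn_odd_lt0 //; lra.
have pos t : x < t -> 0 < (t - x) ^+ k by move=> tx; rewrite exprn_gt0 //; lra.
have [qx0|qx0|/eqP] := ltgtP q.[x] 0; last by rewrite -rootE (negPf qx).
  right; split=> t tx; have := qs t; rewrite nmulr_lgt0 // pt => qt.
    by rewrite nmulr_rgt0 ?neg ?qt //; lra.
  by rewrite pmulr_rlt0 ?pos ?qt //; lra.
left; split=> t tx; have := qs t; rewrite pmulr_lgt0 // pt => qt.
  by rewrite nmulr_rlt0 ?neg ?qt //; lra.
by rewrite pmulr_rgt0 ?pos ?qt //; lra.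
Qed.

(** * Numerical estimates for powers of 1/e *)

Lemma expR_half_bounds (R : realType) (l u l' u' x : R) : 0 <= l ->
  l <= expR (x / 2) <= u -> l' <= l ^+ 2 -> u ^+ 2 <= u' -> l' <= expR x <= u'.
Proof.
move=> l0 /andP[lz zu] ll uu.
have -> : expR x = expR (x / 2) ^+ 2 by rewrite -expRM_natl mulrC divfK ?pnatr_eq0.
apply/andP; split; first by apply: le_trans ll _; rewrite lerXn2r ?nnegrE ?expR_ge0.
by apply: le_trans uu; rewrite lerXn2r ?nnegrE ?expR_ge0 // (le_trans _ zu) ?expR_ge0.
Qed.

(* Squares [127/128 <= e^(-1/128) <= 128/129] seven times, each time rounding to
   fractions with small terms. *)
Lemma expRN1_bounds (R : realType) : 3664 / 10000 <= expR (- 1 : R) <= 3694 / 10000.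
Proof.
apply: (expR_half_bounds _ (227 / 375) (1461 / 2404)); [lra| |lra|lra].
apply: (expR_half_bounds _ (340 / 437) (1687 / 2164)); [lra| |lra|lra].
apply: (expR_half_bounds _ (890 / 1009) (2587 / 2930)); [lra| |lra|lra].
apply: (expR_half_bounds _ (803 / 855) (903 / 961)); [lra| |lra|lra].
apply: (expR_half_bounds _ (2165 / 2234) (2309 / 2382)); [lra| |lra|lra].
apply: (expR_half_bounds _ (253 / 257) (2869 / 2914)); [lra| |lra|lra].
apply: (expR_half_bounds _ (127 / 128) (128 / 129)); [lra| |lra|lra].
apply/andP; split; first by apply: le_trans (expR_ge1Dx _); lra.
rewrite -[expR _]invrK -expRN invf_ple ?posrE ?expR_gt0 //; last by lra.
by apply: le_trans (expR_ge1Dx _); lra.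
Qed.

Lemma expRN1_cube_le (R : realType) : expR (- 1 : R) ^+ 3 <= 505 / 10000.
Proof.
have /andP[_ y2] := expRN1_bounds R.
apply: (@le_trans _ _ ((3694 / 10000) ^+ 3)); last by lra.
by apply: lerXn2r; rewrite ?nnegrE ?expR_ge0 ?divr_ge0.
Qed.

(** The base is 1 / (1 + 1/N), and 1 + 1/N <= e^(1/N). *)
Lemma expRN1_le (R : realType) (N : nat) : (0 < N)%N ->
  expR (- 1 : R) <= (1 - N.+1%:R^-1) ^+ N.
Proof.
move=> N0; have n0 : 0 < N%:R :> R by rewrite ltr0n.
have -> : 1 - N.+1%:R^-1 = (1 + N%:R^-1)^-1 :> R.
  by rewrite -(nat1r N); field; lra.
have -> : expR (- 1 : R) = (expR N%:R^-1)^-1 ^+ N.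
  by rewrite -expRN -expRM_natl mulrN mulfV ?gt_eqF.
have i0 : 0 < N%:R^-1 :> R by rewrite invr_gt0.
apply: lerXn2r; rewrite ?nnegrE ?invr_ge0 ?expR_ge0 //; first by lra.
by rewrite lef_pV2 ?posrE ?expR_gt0 ?expR_ge1Dx //; lra.
Qed.

(* [(N - 2) / (N + 1) <= (1 - 1/N)^3] amounts to [2 N - 1 >= 0]. *)
Lemma le_expRN1_cube (R : realType) (N : nat) : (1 < N)%N ->
  (1 - 3 / N.+1%:R) ^+ N <= expR (- 1 : R) ^+ 3.
Proof.
move=> N1; have n1 : 2 <= N%:R :> R by rewrite (ler_nat R 2).
have -> : expR (- 1 : R) ^+ 3 = (expR (- N%:R^-1) ^+ 3) ^+ N.
  rewrite -exprM mulnC exprM -(expRM_natl N) mulrN mulfV //; lra.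
have i1 : N%:R^-1 <= 1 :> R by rewrite invf_le1; lra.
apply: lerXn2r; rewrite ?nnegrE ?exprn_ge0 ?expR_ge0 //.
  rewrite subr_ge0 ler_pdivrMr -(nat1r N); lra.
apply: (@le_trans _ _ ((1 - N%:R^-1) ^+ 3)).
  rewrite -(nat1r N) -subr_ge0.
  have -> : (1 - N%:R^-1) ^+ 3 - (1 - 3 / (1 + N%:R)) =
     (2 * N%:R - 1) / (N%:R ^+ 3 * (1 + N%:R)) :> R by field; lra.
  by rewrite divr_ge0 ?mulr_ge0 ?exprn_ge0 //; lra.
apply: lerXn2r; rewrite ?nnegrE ?expR_ge0 ?subr_ge0 //.
exact: expR_ge1Dx.
Qed.

(* With n = N + 1, this is what the bounds on nRel require for f(3/n) < f(1/n)
   when m = 0.0851 n^2. In the limit it reads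
   0.0851 (3 - 3 e^-3 - e^-1) < e^-1 - 3 e^-3, by so small a margin that
   replacing [a] and [b] by their limits is affordable only for large N. *)
Lemma key_estimate (R : realType) (N : nat) (a := (1 - N.+1%:R^-1) ^+ N : R)
    (b := (1 - 3 / N.+1%:R) ^+ N : R) : (3 <= N)%N ->
  0 <= 3 * (1 - b) - a /\
  851 / 10000 * N.+1%:R * (3 * (1 - b) - a) < N%:R * (a - 3 * b).
Proof.
(* The values N = 3, ..., 63 are checked one by one in exact rational arithmetic. *)
move=> N3; have [N64|] := leqP 64 N; last first.
  rewrite {}/a {}/b; move: N N3; do 3 case=> [//|].
  by do 61 (case=> [_ _|]; first by split; lra).
have a1 : a <= 1.
  by apply: exprn_ile1; rewrite ?subr_ge0 ?invf_le1 ?ler1n ?ltr0n // gerBl invr_ge0.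
have /andP[y1 _] := expRN1_bounds R.
have a2 : 3664 / 10000 <= a.
  by apply: le_trans y1 (expRN1_le _ _ _); apply: leq_trans N64.
have b1 : b <= 505 / 10000.
  by apply: le_trans (expRN1_cube_le R); apply: le_expRN1_cube; apply: leq_trans N64.
clearbody a b; clear y1.
have n64 : 64 <= N%:R :> R by rewrite (ler_nat R 64).
split; first by lra.
(* The worst case is a = 0.3664, b = 0.0505. It requires about 0.21123 (N+1) < 0.2149 N, which holds
   from N = 58 on. *)
rewrite -(nat1r N); nra.
Qed.

(** * From values to slopes to inflections *)

Lemma poly_increasing_slope (R : realType) (p : {poly R}) (a b : R) :
  a < b -> p.[a] < p.[b] -> exists2 c, a < c < b & 0 < p^`().[c].
Proof.
move=> ab pab; have [c] := poly_mvt p ab; rewrite in_itv /= => cab pE; exists c => //.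
by rewrite -(@pmulr_lgt0 _ (b - a)) -?pE; lra.
Qed.

Lemma poly_decreasing_slope (R : realType) (p : {poly R}) (a b : R) :
  a < b -> p.[b] < p.[a] -> exists2 c, a < c < b & p^`().[c] < 0.
Proof.
move=> ab pab; have [|c cab] := poly_increasing_slope _ (- p) a b ab; first by rewrite !hornerN; lra.
by rewrite derivN hornerN oppr_gt0; exists c.
Qed.

Lemma two_inflections (R : realType) (f : {poly R}) (a b : R) :
  0 < a -> a < b -> b < 1 ->
  f.[0] < f.[a] -> f.[b] < f.[a] -> f.[b] < f.[1] -> f^`().[1] = 0 ->
  exists x y : R, [/\ 0 < x < 1, 0 < y < 1, x != y & inflection f x /\ inflection f y].
Proof.
move=> a0 ab b1 f0a fba fb1 f1.
have [c1 c1i c1s] := poly_increasing_slope _ f _ _ a0 f0a.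
have [c2 c2i c2s] := poly_decreasing_slope _ f _ _ ab fba.
have [c3 c3i c3s] := poly_increasing_slope _ f _ _ b1 fb1.
have [||d1 d1i d1s] := poly_decreasing_slope _ f^`() c1 c2; try lra.
have [||d2 d2i d2s] := poly_increasing_slope _ f^`() c2 c3; try lra.
have [||d3 d3i d3s] := poly_decreasing_slope _ f^`() c3 1; try lra.
have [||x xi xs] := poly_sign_change _ f^`()^`() d1 d2; [lra|by rewrite nmulr_rlt0|].
have [||y yi ys] := poly_sign_change _ f^`()^`() d2 d3; [lra|by rewrite pmulr_rlt0|].
by exists x, y; split; [lra|lra|rewrite lt_eqF //; lra|split].
Qed.

(** * Consequences of 2-connectedness and the conclusion *)

(* Removing one vertex leaves a connected graph, so every disconnected set
   misses at least two vertices. *)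
Lemma nRel_near1 (R : realType) (T : finType) (e : rel T) : two_connected e ->
  exists q : {poly R}, nRel R e = 1 - (1 - 'X) ^+ 2 * q.
Proof.
case/and3P=> _ cT /forallP cV.
exists (\sum_(C : {set T} | ~~ connected_set e C) 'X ^+ #|C| * (1 - 'X) ^+ (#|T| - #|C| - 2)).
rewrite -[X in _ = X - _](sum_weights _ T 'X (1 - 'X)) ?subrKC // [in RHS](bigID (connected_set e)) /=.
rewrite -addrA [X in _ + X](_ : _ = 0) ?addr0 //.
apply/eqP; rewrite subr_eq0 mulr_sumr; apply/eqP; apply: eq_bigr => C nC.
rewrite mulrCA -exprD subnKC //.
have -> : (#|T| - #|C|)%N = #|~: C| by rewrite [RHS]cardsCs setCK.
rewrite ltn_neqAle card_gt0; apply/andP; split; last first.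
  by apply: contraNneq nC => C0; rewrite -(setCK C) C0 setC0.
by rewrite eq_sym; apply: contraNN nC => /cards1P[v Cv]; rewrite -(setCK C) Cv.
Qed.

(** This serves to exclude order 3, where 3/n would not lie inside (0,1). *)
Lemma two_connected_edges (T : finType) (e : rel T) : two_connected e ->
  (#|T|.-1 <= gsize e)%N.
Proof.
case/and3P=> _ cT _; rewrite -cardsT; apply: leq_trans (connected_set_edges _ _ _ cT) _.
by apply: subset_leq_card; apply/subsetP=> E; rewrite inE => /andP[].
Qed.

Theorem theorem3p4 (R : realType) (T : finType) (e : rel T)
  (e_sym : symmetric e) (e_irr : irreflexive e) :
  (10000 * gsize e <= 851 * (gorder T) ^ 2)%N ->
  two_connected e ->
  exists x y : R,
    [/\ 0 < x < 1, 0 < y < 1, x != y &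
        inflection (nRel R e) x /\ inflection (nRel R e) y].
Proof.
rewrite /gorder => m_le e2; have m_ge := two_connected_edges _ _ e2.
have T2 : (2 < #|T|)%N by case/and3P: e2.
have [N [TN N3]] : exists N, #|T| = N.+1 /\ (3 <= N)%N.
  exists #|T|.-1; rewrite (ltn_predK T2); split=> //; rewrite -ltnS (ltn_predK T2).
  (* For n = 3 there are at least 2 edges, but 20000 > 851 * 9. *)
  rewrite ltn_neqAle T2 andbT; apply: contraTneq m_le => T3; rewrite -T3 -ltnNge.
  by apply: (@leq_trans (10000 * 2)); rewrite // leq_mul2l /= (leq_trans _ m_ge) // -T3.
have [q fE] := nRel_near1 R _ _ e2.
set f := nRel R e in fE *; set m := gsize e in m_le m_ge.
have n0 : 4 <= N.+1%:R :> R by rewrite (ler_nat R 4).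
have i0 : 0 < N.+1%:R^-1 :> R by rewrite invr_gt0 ltr0n.
have i4 : 4 * N.+1%:R^-1 <= 1 :> R by rewrite ler_pdivrMr ?mul1r ?ltr0n.
have f0 : f.[0] = 0.
  rewrite /f horner_nRel big1 // => C /andP[]; rewrite -card_gt0 => C0 _.
  by rewrite expr0n gtn_eqF // mul0r.
have f1 : f.[1] = 1 by rewrite fE !hornerE subrr expr0n mul0r subr0.
have f'1 : f^`().[1] = 0.
  by rewrite fE !derivE !hornerE; ring.
have Nn0 : N%:R != 0 :> R by rewrite pnatr_eq0 -lt0n (leq_trans _ N3).
set i := N.+1%:R^-1 in i0 i4.
have p1 : (0 : R) <= i <= 1 by lra.
have p2 : (0 : R) <= 3 * i <= 1 by lra.
have [i1 i3 i31] : [/\ i < 1, i < 3 * i & 3 * i < 1] by split; lra.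
have lo := nRel_lower R _ _ e_sym e_irr _ p1.
have hi := nRel_upper R _ _ e_irr _ p2.
have le1 := nRel_le1 R _ e _ p1.
rewrite -/f -/m TN /= in lo hi le1.
have [D0 key] := key_estimate R N N3; rewrite -/i in D0 key.
set a : R := (1 - i) ^+ N in lo D0 key.
set b : R := (1 - 3 * i) ^+ N in hi D0 key.
have ni : N.+1%:R * i = 1 by rewrite mulfV ?pnatr_eq0.
have a0 : 0 < a by rewrite exprn_gt0 ?subr_gt0.
(* Since 1 - i = N i, the edge term m i^2 (1-i)^(N-1) of the lower bound equals m i a / N. *)
have aE : a = (1 - i) ^+ N.-1 * (N%:R * i).
  have -> : N%:R * i = 1 - i by rewrite -[X in X - i]ni -(natr1 N) mulrDl mul1r addrK.
  by rewrite /a -exprSr (ltn_predK N3).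
have m0 : 0 <= m%:R * i by rewrite mulr_ge0 // ltW.
have mR : m%:R * i <= 851 / 10000 * N.+1%:R.
  have : (10000 * m)%:R <= (851 * N.+1 ^ 2)%:R :> R by rewrite ler_nat -TN.
  by rewrite ler_pdivrMr ?ltr0n // !natrM; lra.
have loE : a + m%:R * i * a / N%:R <= f.[i].
  apply: le_trans lo; rewrite le_eqVlt; apply/orP; left; apply/eqP.
  rewrite ni mul1r; congr (_ + _).
  by rewrite aE; field; rewrite Nn0.
have hiE : f.[3 * i] <= 3 * b + m%:R * i * (3 * (1 - b)) / N%:R.
  apply: le_trans hi _; rewrite le_eqVlt; apply/orP; left; apply/eqP.
  by rewrite (mulrCA _ 3) ni; field; rewrite Nn0.
have drop : f.[3 * i] < f.[i].
  apply: le_lt_trans hiE _; apply: lt_le_trans loE; rewrite -subr_gt0.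
  have -> : a + m%:R * i * a / N%:R - (3 * b + m%:R * i * (3 * (1 - b)) / N%:R)
    = (N%:R * (a - 3 * b) - m%:R * i * (3 * (1 - b) - a)) / N%:R by field; rewrite Nn0.
  rewrite divr_gt0 ?subr_gt0 ?ltr0n ?(leq_trans _ N3) //.
  (* By [D0] the numerator is smallest for the largest m, so [mR] reduces the claim to [key]. *)
  by apply: le_lt_trans key; apply: ler_wpM2r.
apply: (two_inflections _ f i (3 * i)) => //; rewrite ?f0 ?f1.
  by apply: lt_le_trans loE; rewrite ltr_wpDr // !mulr_ge0 ?invr_ge0 // ltW.
exact: lt_le_trans drop le1.
Qed.
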